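(* For every $\phi \in L^1(\mathbb{R}_+)$, $f \in L^{\infty}(\mathbb{R}_+)$ and $\omega \in \Omega^*$, \[(U_{\phi}^*f)_{\omega}(x) = \int_{-\infty}^{\infty} f_{\omega}(x+t)\tilde{\phi}(t)\,dt = (f_{\omega} * \phi^* )(x)\quad\text{for every } x\in\mathbb{R},\] where $\tilde\phi$ equals $\phi$ on $[0,\infty)$ and $0$ on $(-\infty,0)$, and $\phi^*(x) = 0$ for $x\ge 0$, $\phi^*(x) = \phi(-x)$ for $x<0$.
   Context: $\mathbb{R}_+=[0,\infty)$; functions are complex-valued. $(U^*_\phi f)(x) = \int_x^\infty f(t)\phi(t-x)\,dt$. Convolution: $(g*h)(x) = \int_{-\infty}^\infty g(x-t)h(t)\,dt$. Let $\beta\mathbb{N}$ be the Stone–Čech compactification of $\mathbb{N}$, $\mathbb{N}^* = \beta\mathbb{N}\setminus\mathbb{N}$, $\tau$ the continuous extension of $n\mapsto n+1$. $\Omega$ is the quotient of $\beta\mathbb{N}\times[0,1]$ identifying $(\eta,1)$ with $(\tau\eta,0)$; $\Omega^*$ consists of classes $(\eta,u)$ with $\eta\in\mathbb{N}^*$; $\tau^s(\eta,u) = (\tau^{[u+s]}\eta, u+s-[u+s])$. Each $\omega=(\eta,u)$ is identified with the ultrafilter on $\mathbb{R}_+$ generated by $\{u+A: A\in\eta\}$. For $g\in L^\infty(\mathbb{R}_+)$, $g_\omega := \omega\text{-}\lim_s g(\cdot+s)$ in the weak* topology of $L^\infty(\mathbb{R}_+)$, extended to $L^\infty(\mathbb{R})$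 by $g_\omega(x) = g_{\tau^{-N}\omega}(N+x)$ for $x\in[-N,0]$. *)

(* Defs.v *)
From HB Require Import structures.
From mathcomp Require Import all_boot all_order all_algebra.
From mathcomp Require Import all_classical all_reals all_analysis.
From mathcomp Require Import complex.
Set Implicit Arguments. Unset Strict Implicit. Unset Printing Implicit Defensive.
Import Order.TTheory GRing.Theory Num.Theory.
Local Open Scope classical_set_scope.
Local Open Scope ring_scope.

Section Defs.
Variable R : realType.
Local Notation C := (R[i]).
Local Notation mu := (@lebesgue_measure R).

Definition Rplus : set R := [set x | 0 <= x].

Definition cmeasurable (D : set R) (f : R -> C) :=
  measurable_fun D (fun x => complex.Re (f x)) /\
  measurable_fun D (fun x => complex.Im (f x)).

Definition L1 (D : set R) (f : R -> C) :=
  cmeasurable D f /\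
  mu.-integrable D (fun x => (complex.Re (f x))%:E) /\
  mu.-integrable D (fun x => (complex.Im (f x))%:E).

Definition Linf (D : set R) (f : R -> C) :=
  cmeasurable D f /\
  exists M : R, {ae mu, forall x, D x -> ComplexField.Normc.normc (f x) <= M}.

Definition cint (D : set R) (f : R -> C) : C :=
  Complex (Rintegral mu D (fun x => complex.Re (f x)))
          (Rintegral mu D (fun x => complex.Im (f x))).

Definition Ustar (phi f : R -> C) (x : R) : C :=
  cint [set t | x <= t] (fun t => f t * phi (t - x)).

Definition convol (g h : R -> C) (x : R) : C :=
  cint setT (fun t => g (x - t) * h t).

Definition phitilde (phi : R -> C) (t : R) : C := if 0 <= t then phi t else 0.
Definition phistar (phi : R -> C) (t : R) : C := if t < 0 then phi (- t) else 0.
End Defs.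
Arguments Rplus R : clear implicits.

(** Stone--Cech compactification of N realised as ultrafilters on N *)
Definition is_ultrafilter (T : Type) (U : set (set T)) :=
  [/\ ~ U set0, U setT,
      (forall A B, U A -> U B -> U (A `&` B)),
      (forall A B, A `<=` B -> U A -> U B) &
      (forall A, U A \/ U (~` A))].

(** element of N^* = betaN \ N : non-principal ultrafilter *)
Definition in_Nstar (eta : set (set nat)) :=
  is_ultrafilter eta /\ forall n : nat, ~ eta [set n].

(** tau : continuous extension of n |-> n+1; tau eta = {B | B - 1 in eta} *)
Definition tau (eta : set (set nat)) : set (set nat) :=
  [set B | eta [set n | B n.+1]].
(** its inverse on N^*: tau^{-1} eta = {B | B + 1 in eta} *)
Definition tauinv (eta : set (set nat)) : set (set nat) :=
  [set B | eta ((fun n => n.+1) @` B)].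

Section Omega.
Variable R : realType.
Local Notation C := (R[i]).
Local Notation mu := (@lebesgue_measure R).

(** the ultrafilter on R_+ generated by {u + A : A in eta}, identified with
    omega = (eta, u) *)
Definition omega_filter (eta : set (set nat)) (u : R) : set (set R) :=
  [set S | exists A, eta A /\ forall n : nat, A n -> S (u + n%:R)].

Definition omega_lim (eta : set (set nat)) (u : R) (a : R -> C) (l : C) :=
  forall e : R, 0 < e -> omega_filter eta u [set s | ComplexField.Normc.normc (a s - l) < e].

(** G represents g_omega = omega-lim_s g(. + s) in the weak* topology of
    L^oo(R_+) = L^1(R_+)^* *)
Definition omega_rep (eta : set (set nat)) (u : R) (g G : R -> C) :=
  Linf (Rplus R) G /\
  forall h : R -> C, L1 (Rplus R) h ->
    omega_lim eta u (fun s => cint (Rplus R) (fun x => g (x + s) * h x))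
                    (cint (Rplus R) (fun x => G x * h x)).

(** F : R -> C represents g_omega extended to R by
    g_omega(x) = g_{tau^{-N} omega}(N + x) for x in [-N, 0] *)
Definition omega_ext_rep (eta : set (set nat)) (u : R) (g F : R -> C) :=
  omega_rep eta u g F /\
  forall N : nat, exists G, omega_rep (iter N tauinv eta) u g G /\
    {ae mu, forall x, - (N%:R) <= x <= 0 -> F x = G (N%:R + x)}.
End Omega.

(* Main.v *)
(** With [cor F phi x = int F(x+t) phi~(t) dt], where [phi~] is the extension of
    [phi] by zero, one has [Ustar phi f = cor f phi~], and Fubini gives, for
    [s >= 0] and [h] in L^1(R_+),
    [int_{x>=0} cor f phi~ (x+s) h(x) dx = int_{y>=0} f(y+s) (h~ * phi~)(y) dy].
    As [h~ * phi~] is integrable and vanishes on the negative half-line, it is a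
    legitimate test function for the weak* limit of the translates of [f]; passing
    to the limit and using the same identity for [f_omega] with [s = 0] shows that
    the translates of [Ustar phi f] tend to [cor f_omega phi~].  On the negative
    half-line the claim reduces to this one applied to [tau^-N omega], because
    [f_omega] and [f_{tau^-N omega}(N + .)] agree almost everywhere on [[-N, oo)]
    by uniqueness of weak* limits. *)

Require Import Defs.
From HB Require Import structures.
From mathcomp Require Import all_boot all_order all_algebra.
From mathcomp Require Import all_classical all_reals all_analysis.
From mathcomp Require Import measurable_realfun complex ring lra.
Import Order.TTheory GRing.Theory Num.Theory.
Import numFieldNormedType.Exports.
Local Open Scope classical_set_scope.
Local Open Scope ring_scope.

(** * Integrals of functions that need not be measurable *)

Section LowerIntegral.
Local Open Scope ereal_scope.
Context (d : measure_display) (T : measurableType d) (R : realType).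
Variable mu : {measure set T -> \bar R}.
Implicit Types f g : T -> \bar R.
Import HBNNSimple.

Lemma ae_impl (P Q : T -> Prop) : (forall x, P x -> Q x) ->
  {ae mu, forall x, P x} -> {ae mu, forall x, Q x}.
Proof. by move=> PQ; apply: filterS. Qed.

Lemma ae_impl2 (P Q S : T -> Prop) : (forall x, P x -> Q x -> S x) ->
  {ae mu, forall x, P x} -> {ae mu, forall x, Q x} -> {ae mu, forall x, S x}.
Proof. by move=> PQS; apply: filterS2. Qed.

(** The integral of a nonnegative function is a supremum over its simple minorants, so an inequality
    of integrals can be checked one minorant [h] of [f] at a time, with neither [f] nor [g]
    measurable. *)
Lemma ge0_integral_le_nnsfun f g :
  (forall x, 0 <= f x) -> (forall x, 0 <= g x) ->
  (forall h : {nnsfun T >-> R}, (forall x, (h x)%:E <= f x) ->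
    exists2 k : T -> \bar R, (forall x, 0 <= k x <= g x) &
      measurable_fun [set: T] k /\ \int[mu]_x (h x)%:E <= \int[mu]_x k x) ->
  \int[mu]_x f x <= \int[mu]_x g x.
Proof.
move=> f0 g0 fg; rewrite ge0_integralTE//.
apply: ge_ereal_sup => _ [h /= hf <-].
have [k kg [mk hk]] := fg h hf.
rewrite (_ : sintegral mu h = \int[mu]_x (h x)%:E); last first.
  by rewrite integral_nnsfun// patch_setT.
apply: (le_trans hk); rewrite [leLHS]ge0_integralTE => [|x]; last first.
  by have /andP[] := kg x.
rewrite ge0_integralTE//; apply: le_ereal_sup => _ [l /= lk <-].
by exists l => //= x; apply: (le_trans (lk x)); have /andP[] := kg x.
Qed.

(* Measurability cannot be assumed: a representative of [f_omega] on the negative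
   half-line is only almost everywhere equal to a Borel function.  The library's
   integral is a lower integral, a supremum over simple functions, so it is
   nevertheless insensitive to null sets. *)
Lemma ae_eq_integral_nonmeasurable (D : set T) f g :
  ae_eq mu D f g -> \int[mu]_(x in D) f x = \int[mu]_(x in D) g x.
Proof.
have ge0_le (f1 f2 : T -> \bar R) :
    (forall x, 0 <= f1 x) -> (forall x, 0 <= f2 x) ->
    {ae mu, forall x, f1 x = f2 x} -> \int[mu]_x f1 x <= \int[mu]_x f2 x.
  move=> f1_0 f2_0 [Z [mZ Z0 subZ]]; apply: ge0_integral_le_nnsfun => // h hf.
  (* Cutting [h] off on the null set [Z], which contains the points where [f1] and [f2] differ, puts
     it below [f2] and keeps its integral. *)
  exists ((fun x => (h x)%:E) \_ (~` Z)); last split.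
  - move=> x; rewrite patchE; case: ifPn => [|_]; last by rewrite lexx f2_0.
    rewrite inE => nZx; rewrite lee_fin fun_ge0/=.
    have -> : f2 x = f1 x.
      by apply: contrapT => ne; apply: nZx; apply: subZ => /esym.
    exact: hf.
  - apply/(measurable_restrictT _ _).1; first exact: measurableC.
    by apply/measurable_EFinP; apply: measurable_funTS.
  - rewrite -integral_mkcond -setTD.
    rewrite [leLHS](ge0_negligible_integral mZ)//.
    + by apply/measurable_EFinP; apply: measurable_funTS.
    + by move=> x _; rewrite lee_fin.
have ge0_eq (f1 f2 : T -> \bar R) :
    (forall x, 0 <= f1 x) -> (forall x, 0 <= f2 x) ->
    {ae mu, forall x, f1 x = f2 x} -> \int[mu]_x f1 x = \int[mu]_x f2 x.
  move=> f1_0 f2_0 f12; apply/eqP; rewrite eq_le !ge0_le//.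
  by apply: filterS f12 => x ->.
move=> fg; rewrite !(integral_mkcond D).
have {}fg : {ae mu, forall x, (f \_ D) x = (g \_ D) x}.
  apply: filterS fg => x fg; rewrite !patchE; case: ifPn => //.
  by rewrite inE => /fg.
rewrite integralE [RHS]integralE; congr (_ - _); apply: ge0_eq => //;
  by apply: filterS fg => x; rewrite !(funeposE,funenegE) => ->.
Qed.

End LowerIntegral.

(** * Reflections and translations of the line *)

Section Reflection.
Context {R : realType}.
Local Notation mu := (@lebesgue_measure R).
Import HBNNSimple.

Lemma measurable_reflect (a : R) : measurable_fun setT (fun x : R => a - x).
Proof. by apply: measurable_funB. Qed.

(** Lebesgue measure is determined by its values on the intervals []p, q]], and the reflection of
    such an interval is [[a - q, a - p[], of the same length. *)
Lemma lebesgue_measure_reflect (a : R) (A : set R) :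
  measurable A -> mu ((fun x => a - x) @^-1` A) = mu A.
Proof.
move=> mA; symmetry.
have mr : measurable_fun [set: measurableTypeR R]
    (fun x : R => (a - x : measurableTypeR R)) := measurable_reflect a.
pose r_mixin := isMeasurableFun.Build _ _ _ _ _ mr.
pose r : {mfun measurableTypeR R >-> measurableTypeR R} :=
  HB.pack (fun x : R => (a - x : measurableTypeR R)) r_mixin.
apply: (@lebesgue_measure_unique _ (pushforward mu r)) => // X [[p q] _ <-] /=.
rewrite /pushforward /=.
have -> : (fun x => a - x) @^-1` `]p, q]%classic = `[a - q, a - p[%classic.
  apply/seteqP; split => x /=; rewrite !in_itv/=; lra.
rewrite !lebesgue_measure_itv/= !lte_fin.
rewrite [X in if X then _ else _](_ : (p < q) = (a - q < a - p)); last lra.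
by case: ifP => // _; rewrite -!EFinD; congr EFin; lra.
Qed.

Lemma ae_reflect (a : R) (P : R -> Prop) :
  {ae mu, forall x, P x} -> {ae mu, forall x, P (a - x)}.
Proof.
move=> [Z [mZ Z0 subZ]]; exists ((fun x => a - x) @^-1` Z); split.
- by rewrite -[X in measurable X]setTI; apply: measurable_reflect.
- by rewrite lebesgue_measure_reflect.
- by move=> x nP; apply: subZ.
Qed.

(** Stated for arbitrary [f], as later integrands may be nonmeasurable. For nonnegative functions,
    reflecting simple minorants gives one inequality; the other follows because the reflection is an
    involution. *)
Lemma integral_reflect (a : R) (f : R -> \bar R) :
  (\int[mu]_x f (a - x)%R = \int[mu]_x f x)%E.
Proof.
have reflK (g : R -> \bar R) : (fun x => g (a - (a - x))) = g.
  by apply/funext => x; rewrite opprB addrC subrK.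
have ge0_le (g : R -> \bar R) : (forall x, 0 <= g x)%E ->
    (\int[mu]_x g x <= \int[mu]_x g (a - x)%R)%E.
  move=> g0; apply: ge0_integral_le_nnsfun => // h hg.
  have mh : measurable_fun setT (fun x => (h x)%:E).
    by apply/measurable_EFinP.
  exists (fun x => (h (a - x))%:E); last split.
  - by move=> x; rewrite lee_fin fun_ge0/=.
  - exact: (measurableT_comp mh (measurable_reflect a)).
  - rewrite le_eqVlt; apply/orP; left; apply/eqP.
    have mr : measurable_fun [set: measurableTypeR R]
        (fun x : R => (a - x : measurableTypeR R)) := measurable_reflect a.
    rewrite -(ge0_integral_pushforward mr _ measurableT mh).
      apply: eq_measure_integral => A mA _; symmetry.
      exact: lebesgue_measure_reflect.
    by move=> x _; rewrite lee_fin.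
have ge0_eq (g : R -> \bar R) : (forall x, 0 <= g x)%E ->
    (\int[mu]_x g (a - x)%R = \int[mu]_x g x)%E.
  move=> g0; apply/eqP; rewrite eq_le ge0_le// andbT.
  by rewrite -[leRHS](congr1 (integral mu setT) (reflK g)); apply: ge0_le.
rewrite integralE [RHS]integralE -(ge0_eq (f^\+)%E)// -(ge0_eq (f^\-)%E)//.
by congr (_ - _)%E; apply: eq_integral => x _; rewrite !(funeposE,funenegE).
Qed.

(** A translation is the composite of two reflections; the same device yields [integral_translate]
    and [integrable_translate]. *)
Lemma ae_translate (a : R) (P : R -> Prop) :
  {ae mu, forall x, P x} -> {ae mu, forall x, P (x + a)}.
Proof.
move=> /(ae_reflect a)/(ae_reflect 0).
by apply: ae_impl => x; rewrite sub0r opprK addrC.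
Qed.

Lemma integral_translate (a : R) (f : R -> \bar R) :
  (\int[mu]_x f (x + a)%R = \int[mu]_x f x)%E.
Proof.
rewrite -(integral_reflect a f) -(integral_reflect 0).
by apply: eq_integral => x _; rewrite sub0r addrC.
Qed.

Lemma measurable_translate (a : R) (f : R -> R) :
  measurable_fun setT f -> measurable_fun setT (fun x : R => f (x + a)).
Proof.
by move=> mf; apply: (measurableT_comp mf); apply: measurable_funD.
Qed.

Lemma integrable_reflect (a : R) (f : R -> R) :
  mu.-integrable setT (EFin \o f) ->
  mu.-integrable setT (EFin \o (fun x : R => f (a - x))).
Proof.
move=> /integrableP[/measurable_EFinP mf foo]; apply/integrableP; split.
  by apply/measurable_EFinP; exact: (measurableT_comp mf (measurable_reflect a)).
by rewrite (integral_reflect a (fun x : R => `|(EFin \o f) x|)%E).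
Qed.

Lemma integrable_translate (a : R) (f : R -> R) :
  mu.-integrable setT (EFin \o f) ->
  mu.-integrable setT (EFin \o (fun x : R => f (x + a))).
Proof.
move=> /(integrable_reflect a)/(integrable_reflect 0).
by congr integrable; apply/funext => x /=; rewrite sub0r opprK addrC.
Qed.

End Reflection.

(** * Correlation and convolution of real functions *)

Section RealConvolution.
Context {R : realType}.
Local Notation mu := (@lebesgue_measure R).
Implicit Types f g h phi : R -> R.

Definition correlation f phi (x : R) : R := \int[mu]_t (f (x + t) * phi t).

Definition convolution h phi (y : R) : R := \int[mu]_x (h x * phi (y - x)).

(** The bound is pointwise rather than essential, so that correlations are bounded and well behaved
    at every point; [Linf_bounded_rep] brings essentially bounded functions to this form. *)
Definition bounded_measurable f :=
  measurable_fun setT f /\ exists M : R, forall x, `|f x| <= M.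

Lemma bounded_measurable_translate a f :
  bounded_measurable f -> bounded_measurable (fun x : R => f (x + a)).
Proof.
by move=> [mf [M fM]]; split; [exact: measurable_translate|exists M].
Qed.

Lemma bounded_measurable_mul_integrable f phi :
  bounded_measurable f -> mu.-integrable setT (EFin \o phi) ->
  mu.-integrable setT (EFin \o (fun x : R => f x * phi x)).
Proof.
move=> [mf [M fM]] iphi.
apply: (le_integrable measurableT _ _ (integrableZl measurableT M iphi)).
  apply/measurable_EFinP; apply: measurable_funM => //.
  by apply/measurable_EFinP; exact: measurable_int iphi.
move=> x _ /=; rewrite lee_fin !normrM ler_wpM2r//.
by rewrite (le_trans (fM x))// ler_norm.
Qed.

(** By Tonelli: integrating the absolute value in [y] first gives, by translation invariance, at
    most [M * c * |h x|] with [c] the L^1 norm of [phi], and this is integrable in [x]. *)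
Lemma integrable_convolution_kernel f h phi : bounded_measurable f ->
  mu.-integrable setT (EFin \o h) -> mu.-integrable setT (EFin \o phi) ->
  (mu \x mu)%E.-integrable setT
    (EFin \o (fun z : R * R => f z.2 * (h z.1 * phi (z.2 - z.1)))).
Proof.
move=> bf ih iphi; have [mf [M fM]] := bf.
have mh : measurable_fun setT h.
  by apply/measurable_EFinP; exact: measurable_int ih.
have mphi : measurable_fun setT phi.
  by apply/measurable_EFinP; exact: measurable_int iphi.
set kern := fun z : R * R => _.
have measurable_kern : measurable_fun setT kern.
  apply: measurable_funM; first exact: (measurableT_comp mf measurable_snd).
  apply: measurable_funM; first exact: (measurableT_comp mh measurable_fst).
  apply: (measurableT_comp mphi).
  by apply: measurable_funB; [exact: measurable_snd|exact: measurable_fst].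
apply/integrable12ltyP; first exact/measurable_EFinP.
have mabsphi : measurable_fun setT (fun y : R => `|phi y|).
  exact: (measurableT_comp _ mphi).
have iphi_abs := integrable_norm iphi.
have ih_abs := integrable_norm ih.
pose c := \int[mu]_x `|phi x|.
have M0 : 0 <= M by exact: le_trans (fM 0).
have Mc0 : 0 <= M * c by rewrite mulr_ge0// Rintegral_ge0.
have cE : (\int[mu]_x (`|phi x|)%:E = c%:E)%E.
  rewrite /c /Rintegral fineK//; apply: integrable_fin_num => //.
apply: (@le_lt_trans _ _ (\int[mu]_x ((M * c * `|h x|)%:E))%E); last first.
  have /integrableP[_] := integrableZl measurableT (M * c) ih_abs.
  apply: le_lt_trans; rewrite le_eqVlt; apply/orP; left; apply/eqP.
  apply: eq_integral => x _ /=; congr EFin.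
  by rewrite [RHS]ger0_norm// mulr_ge0.
apply: ge0_le_integral => //.
- by move=> x _; apply: integral_ge0.
- have mabs : measurable_fun setT (fun z : R * R => (`|(EFin \o kern) z|)%E).
    by apply: measurableT_comp => //; apply/measurable_EFinP.
  exact: (measurable_fun_fubini_tonelli_F (m2 := mu) _ mabs (fun=> abse_ge0 _)).
- apply/measurable_EFinP; apply: measurable_funM => //.
  exact: (measurableT_comp _ mh).
- move=> x _ /=.
  apply: (@le_trans _ _ (\int[mu]_y ((M * `|h x|)%:E * (`|phi (y - x)|)%:E))%E).
    apply: ge0_le_integral => //.
    + apply/measurable_EFinP; apply: measurableT_comp => //.
      exact: (measurableT_comp measurable_kern (pair1_measurable x)).
    + apply/measurable_EFinP; apply: measurable_funM => //.
      exact: (measurable_translate (- x) _ mabsphi).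
    + move=> y _; rewrite -EFinM lee_fin /kern/= !normrM mulrA.
      by rewrite ler_wpM2r// ler_wpM2r.
  rewrite ge0_integralZl//; last 2 first.
  - by apply/measurable_EFinP; exact: (measurable_translate (- x) _ mabsphi).
  - by rewrite lee_fin mulr_ge0.
  rewrite (integral_translate (- x) (fun y : R => (`|phi y|)%:E)) cE -EFinM lee_fin.
  by rewrite mulrAC.
Qed.

Lemma Rintegral_translate a f : \int[mu]_x f (x + a) = \int[mu]_x f x.
Proof. by rewrite /Rintegral (integral_translate a (EFin \o f)). Qed.

Lemma Rintegral_reflect a f : \int[mu]_x f (a - x) = \int[mu]_x f x.
Proof. by rewrite /Rintegral (integral_reflect a (EFin \o f)). Qed.

Lemma correlationE f phi x : correlation f phi x = \int[mu]_y (f y * phi (y - x)).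
Proof.
rewrite -(Rintegral_translate x (fun y : R => f y * phi (y - x))).
by apply: eq_Rintegral => t _; rewrite addrK addrC.
Qed.

Lemma bounded_measurable_cst c : bounded_measurable (fun=> c).
Proof. by split=> //; exists `|c|. Qed.

Lemma integrable_correlation f phi x : bounded_measurable f ->
  mu.-integrable setT (EFin \o phi) ->
  mu.-integrable setT (EFin \o (fun t : R => f (x + t) * phi t)).
Proof.
move=> bf; apply: bounded_measurable_mul_integrable.
have := bounded_measurable_translate x f bf.
by under eq_fun do rewrite addrC.
Qed.

Lemma bounded_measurable_correlation f phi : bounded_measurable f ->
  mu.-integrable setT (EFin \o phi) -> bounded_measurable (correlation f phi).
Proof.
move=> bf iphi; have [mf [M fM]] := bf; split; last first.
  exists (M * \int[mu]_t `|phi t|) => x.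
  have inorm := integrable_norm iphi.
  rewrite (le_trans (le_normr_Rintegral _ _))//.
    exact: integrable_correlation.
  rewrite -RintegralZl//; apply: le_Rintegral => //.
  - by apply: integrable_norm; exact: integrable_correlation.
  - exact: (integrableZl measurableT M inorm).
  - by move=> t _; rewrite normrM ler_wpM2r.
pose k (z : R * R) := (f (z.1 + z.2) * phi z.2)%:E.
have mk : measurable_fun setT k.
  apply/measurable_EFinP; apply: measurable_funM.
    apply: (measurableT_comp mf).
    by apply: measurable_funD; [exact: measurable_fst|exact: measurable_snd].
  apply: (measurableT_comp _ measurable_snd).
  by apply/measurable_EFinP; exact: measurable_int iphi.
suff mI : measurable_fun setT
    (fun x : R => \int[mu]_t (f (x + t) * phi t)%:E)%E.
  exact: (measurableT_comp (@fine_measurable R _ measurableT) mI).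
(* Tonelli gives measurability of partial integrals of nonnegative functions, so the positive and
   negative parts are treated separately. *)
under eq_fun do rewrite integralE.
apply: emeasurable_funB.
- have kp0 z : (0 <= (k^\+) z)%E by [].
  have mkp := measurable_funepos mk.
  apply: eq_measurable_fun (measurable_fun_fubini_tonelli_F (m2 := mu) _ mkp kp0).
  by move=> x _; apply: eq_integral => t _; rewrite !funeposE.
- have kn0 z : (0 <= (k^\-) z)%E by [].
  have mkn := measurable_funeneg mk.
  apply: eq_measurable_fun (measurable_fun_fubini_tonelli_F (m2 := mu) _ mkn kn0).
  by move=> x _; apply: eq_integral => t _; rewrite !funenegE.
Qed.

Lemma integrable_convolution h phi :
  mu.-integrable setT (EFin \o h) -> mu.-integrable setT (EFin \o phi) ->
  mu.-integrable setT (EFin \o convolution h phi).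
Proof.
move=> ih iphi.
have iK := integrable_convolution_kernel _ _ _ (bounded_measurable_cst 1) ih iphi.
(* The kernel with its variables exchanged, so that [fubini_F] integrates out [x] and leaves a
   function of [y]. *)
pose K (z : R * R) := ((h z.2 * phi (z.1 - z.2))%:E).
have mK : measurable_fun setT K.
  apply/measurable_EFinP; apply: measurable_funM.
    apply: (measurableT_comp _ measurable_snd).
    by apply/measurable_EFinP; exact: measurable_int ih.
  have mphi : measurable_fun setT phi.
    by apply/measurable_EFinP; exact: measurable_int iphi.
  apply: (measurableT_comp mphi).
  by apply: measurable_funB; [exact: measurable_fst|exact: measurable_snd].
have iKs : (mu \x mu)%E.-integrable setT K.
  apply/integrable12ltyP => //.
  have := (integrable21ltyP mu mu (measurable_int _ iK)).1 iK.
  by under eq_integral do under eq_integral do rewrite /= mul1r.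
have iG := integrable_fubini_F iKs.
have mG := measurable_int _ iG.
(* [convolution h phi] is [fine] of this partial integral: it takes the value 0 where the latter is
   infinite, hence is dominated by it everywhere. *)
apply: (le_integrable measurableT _ _ iG).
  by apply/measurable_EFinP; exact: measurableT_comp.
move=> y _; rewrite /= /convolution /Rintegral /fubini_F /K/=.
by case: (integral _ _ _) => [r| |] //=; rewrite normr0 leey.
Qed.

(** Correlation and convolution with [phi] are adjoint: this moves the operator from [f] onto the
    test function [h]. *)
Lemma Rintegral_correlation f h phi : bounded_measurable f ->
  mu.-integrable setT (EFin \o h) -> mu.-integrable setT (EFin \o phi) ->
  \int[mu]_x (correlation f phi x * h x) =
  \int[mu]_y (f y * convolution h phi y).
Proof.
move=> bf ih iphi; congr fine.
have iK := integrable_convolution_kernel _ _ _ bf ih iphi.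
(* Taking 1 for [f] makes [h x * phi (y - x)] integrable in [x] for almost every [y], including
   those where [f y] vanishes. *)
have iK1 := integrable_convolution_kernel _ _ _ (bounded_measurable_cst 1) ih iphi.
transitivity (\int[mu]_x \int[mu]_y (f y * (h x * phi (y - x)))%:E)%E.
  apply: eq_integral => x _; rewrite correlationE mulrC EFinM.
  have ik : mu.-integrable setT (EFin \o (fun y : R => f y * phi (y - x))).
    apply: bounded_measurable_mul_integrable => //.
    exact: (integrable_translate (- x)).
  rewrite /Rintegral fineK; last exact: integrable_fin_num.
  rewrite -integralZl//; apply: eq_integral => y _.
  by rewrite -EFinM; congr EFin; ring.
rewrite (Fubini iK); apply: ae_eq_integral_nonmeasurable.
apply: ae_impl (ae_integrable2 iK1) => y ik _ /=.
have {}ik : mu.-integrable setT (EFin \o (fun x : R => h x * phi (y - x))).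
  by apply: eq_integrable ik => // x _ /=; rewrite mul1r.
rewrite EFinM /convolution /Rintegral fineK; last exact: integrable_fin_num.
by rewrite -integralZl//; apply: eq_integral => x _; rewrite EFinM.
Qed.

End RealConvolution.

(** * Complex-valued functions *)

Section ComplexIntegral.
Context {R : realType}.
Local Notation C := (R[i]).
Local Notation mu := (@lebesgue_measure R).
Local Notation Re := complex.Re.
Local Notation Im := complex.Im.
Local Notation normc := ComplexField.Normc.normc.
Implicit Types f g h phi F G : R -> C.

Lemma complex_eq (z w : C) : Re z = Re w -> Im z = Im w -> z = w.
Proof. by case: z w => [a b] [c d] /= -> ->. Qed.

Lemma Re_mulc (z w : C) : Re (z * w) = Re z * Re w - Im z * Im w.
Proof. by case: z w => [a b] [c d]. Qed.

Lemma Im_mulc (z w : C) : Im (z * w) = Re z * Im w + Im z * Re w.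
Proof. by case: z w => [a b] [c d]. Qed.

Lemma le_Re_normc (z : C) : `|Re z| <= normc z.
Proof.
case: z => a b /=; rewrite -sqrtr_sqr ler_sqrt; last by rewrite addr_ge0 ?sqr_ge0.
by rewrite lerDl sqr_ge0.
Qed.

Lemma le_Im_normc (z : C) : `|Im z| <= normc z.
Proof.
case: z => a b /=; rewrite -sqrtr_sqr ler_sqrt; last by rewrite addr_ge0 ?sqr_ge0.
by rewrite lerDr sqr_ge0.
Qed.

Lemma normc_le_ReIm (z : C) : normc z <= `|Re z| + `|Im z|.
Proof.
case: z => a b /=; rewrite -[leRHS]ger0_norm ?addr_ge0//.
rewrite -sqrtr_sqr ler_sqrt ?sqr_ge0// sqrrD !real_normK ?num_real//.
by rewrite addrAC lerDl mulrn_wge0// mulr_ge0.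
Qed.

Lemma Rintegral_ae_eq (D : set R) (f g : R -> R) :
  {ae mu, forall x, D x -> f x = g x} ->
  \int[mu]_(x in D) f x = \int[mu]_(x in D) g x.
Proof.
move=> fg; congr fine; apply: ae_eq_integral_nonmeasurable.
by apply: ae_impl fg => x fg /fg ->.
Qed.

Lemma cint_ae_eq (D : set R) f g :
  {ae mu, forall x, D x -> f x = g x} -> cint D f = cint D g.
Proof.
move=> fg; rewrite /cint; congr Complex; apply: Rintegral_ae_eq;
  by apply: ae_impl fg => x fg /fg ->.
Qed.

Lemma eq_cint (D : set R) f g : (forall x, D x -> f x = g x) -> cint D f = cint D g.
Proof. by move=> fg; apply: cint_ae_eq; exact: aeW. Qed.

Lemma cint_mkcond (D : set R) f :
  cint D f = cint setT (fun x => if x \in D then f x else 0).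
Proof.
rewrite /cint; congr Complex; rewrite Rintegral_mkcond;
  by apply: eq_Rintegral => x _; rewrite patchE; case: ifP.
Qed.

(** From here on [phitilde] serves as extension by zero of any function; it moves half-line
    integrals to the whole line, where translation invariance applies. *)
Lemma cint_Rplus f : cint (Rplus R) f = cint setT (phitilde f).
Proof.
rewrite cint_mkcond; apply: eq_cint => x _; rewrite /phitilde.
by have -> : (x \in Rplus R) = (0 <= x) by apply/idP/idP; rewrite inE.
Qed.

Lemma cint_translate a f : cint setT (fun x => f (x + a)) = cint setT f.
Proof.
rewrite /cint (Rintegral_translate a (fun x => Re (f x))).
by rewrite (Rintegral_translate a (fun x => Im (f x))).
Qed.

Lemma cint_reflect a f : cint setT (fun x => f (a - x)) = cint setT f.
Proof.
rewrite /cint (Rintegral_reflect a (fun x => Re (f x))).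
by rewrite (Rintegral_reflect a (fun x => Im (f x))).
Qed.

Definition ccorrelation F phi (x : R) : C := cint setT (fun t => F (x + t) * phi t).

(* The value is assembled from the real convolutions because
   [cint setT (fun x => h x * phi (y - x))] need not split into them on the null
   set of those [y] for which the integrand is not integrable. *)
Definition cconvolution h phi (y : R) : C :=
  let hr x := Re (h x) in let hi x := Im (h x) in
  let pr x := Re (phi x) in let pi x := Im (phi x) in
  Complex (convolution hr pr y - convolution hi pi y)
          (convolution hr pi y + convolution hi pr y).

Definition cbounded_measurable F :=
  bounded_measurable (fun x => Re (F x)) /\ bounded_measurable (fun x => Im (F x)).

Lemma Re_ccorrelation F phi x : cbounded_measurable F -> L1 setT phi ->
  Re (ccorrelation F phi x) =
  correlation (fun x => Re (F x)) (fun x => Re (phi x)) x -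
  correlation (fun x => Im (F x)) (fun x => Im (phi x)) x.
Proof.
move=> [bFr bFi] [_ [ir ii]] /=.
rewrite /correlation -RintegralB//.
- by apply: eq_Rintegral => t _; rewrite Re_mulc.
- exact: (integrable_correlation _ _ x bFr ir).
- exact: (integrable_correlation _ _ x bFi ii).
Qed.

Lemma Im_ccorrelation F phi x : cbounded_measurable F -> L1 setT phi ->
  Im (ccorrelation F phi x) =
  correlation (fun x => Re (F x)) (fun x => Im (phi x)) x +
  correlation (fun x => Im (F x)) (fun x => Re (phi x)) x.
Proof.
move=> [bFr bFi] [_ [ir ii]] /=.
rewrite /correlation -RintegralD//.
- by apply: eq_Rintegral => t _; rewrite Im_mulc.
- exact: (integrable_correlation _ _ x bFr ii).
- exact: (integrable_correlation _ _ x bFi ir).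
Qed.

Lemma bounded_measurableD (f g : R -> R) : bounded_measurable f ->
  bounded_measurable g -> bounded_measurable (fun x => f x + g x).
Proof.
move=> [mf [M fM]] [mg [N gN]]; split; first exact: measurable_funD.
by exists (M + N) => x; rewrite (le_trans (ler_normD _ _))// lerD.
Qed.

Lemma bounded_measurableB (f g : R -> R) : bounded_measurable f ->
  bounded_measurable g -> bounded_measurable (fun x => f x - g x).
Proof.
move=> [mf [M fM]] [mg [N gN]]; split; first exact: measurable_funB.
by exists (M + N) => x; rewrite (le_trans (ler_normB _ _))// lerD.
Qed.

Lemma cbounded_measurable_ccorrelation F phi : cbounded_measurable F ->
  L1 setT phi -> cbounded_measurable (ccorrelation F phi).
Proof.
move=> bF iphi; have [bFr bFi] := bF; have [_ [ir ii]] := iphi; split.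
- under [X in bounded_measurable X]eq_fun do rewrite Re_ccorrelation//.
  by apply: bounded_measurableB; apply: bounded_measurable_correlation.
- under [X in bounded_measurable X]eq_fun do rewrite Im_ccorrelation//.
  by apply: bounded_measurableD; apply: bounded_measurable_correlation.
Qed.

Lemma L1_cconvolution h phi : L1 setT h -> L1 setT phi ->
  L1 setT (cconvolution h phi).
Proof.
move=> [_ [hr hi]] [_ [pr pi]].
have ir : mu.-integrable setT (fun y => (Re (cconvolution h phi y))%:E).
  exact: (integrableB measurableT (integrable_convolution _ _ hr pr)
    (integrable_convolution _ _ hi pi)).
have ii : mu.-integrable setT (fun y => (Im (cconvolution h phi y))%:E).
  exact: (integrableD measurableT (integrable_convolution _ _ hr pi)
    (integrable_convolution _ _ hi pr)).
split=> //; split; apply/measurable_EFinP.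
- exact: (measurable_int _ ir).
- exact: (measurable_int _ ii).
Qed.

(** The real and the imaginary part of a product of three complex numbers each have four terms; the
    coefficients will be 1 or -1. *)
Lemma Rintegral_lin4 (f1 f2 f3 f4 : R -> R) (a b c : R) :
  mu.-integrable setT (EFin \o f1) -> mu.-integrable setT (EFin \o f2) ->
  mu.-integrable setT (EFin \o f3) -> mu.-integrable setT (EFin \o f4) ->
  \int[mu]_x (f1 x + a * f2 x + b * f3 x + c * f4 x) =
  \int[mu]_x f1 x + a * \int[mu]_x f2 x + b * \int[mu]_x f3 x + c * \int[mu]_x f4 x.
Proof.
move=> i1 i2 i3 i4.
have j2 := integrableZl measurableT a i2.
have j3 := integrableZl measurableT b i3.
have j4 := integrableZl measurableT c i4.
have k2 := integrableD measurableT i1 j2.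
have k3 := integrableD measurableT k2 j3.
by rewrite !RintegralD// !RintegralZl.
Qed.

(** Each part splits into four real pairings, and the real adjunction applies to each of them. *)
Lemma cint_ccorrelation F h phi : cbounded_measurable F ->
  L1 setT h -> L1 setT phi ->
  cint setT (fun x => ccorrelation F phi x * h x) =
  cint setT (fun y => F y * cconvolution h phi y).
Proof.
move=> bF ih iphi; have [bFr bFi] := bF.
have [_ [hr hi]] := ih; have [_ [pr pi]] := iphi.
have ic (G k p : R -> R) : bounded_measurable G ->
    mu.-integrable setT (EFin \o k) ->
    mu.-integrable setT (EFin \o p) ->
    mu.-integrable setT (EFin \o (fun x => correlation G p x * k x)).
  move=> bG ik ip; apply: bounded_measurable_mul_integrable => //.
  exact: bounded_measurable_correlation.
have iv (G k p : R -> R) : bounded_measurable G ->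
    mu.-integrable setT (EFin \o k) ->
    mu.-integrable setT (EFin \o p) ->
    mu.-integrable setT (EFin \o (fun x => G x * convolution k p x)).
  move=> bG ik ip; apply: bounded_measurable_mul_integrable => //.
  exact: integrable_convolution.
pose Fr x := Re (F x); pose Fi x := Im (F x).
pose Hr x := Re (h x); pose Hi x := Im (h x).
pose Pr x := Re (phi x); pose Pi x := Im (phi x).
rewrite /cint; congr Complex.
- transitivity (\int[mu]_x (correlation Fr Pr x * Hr x
      + (-1) * (correlation Fi Pi x * Hr x) + (-1) * (correlation Fr Pi x * Hi x)
      + (-1) * (correlation Fi Pr x * Hi x))).
    apply: eq_Rintegral => x _.
    by rewrite Re_mulc Re_ccorrelation// Im_ccorrelation//; ring.
  rewrite Rintegral_lin4; [|exact: ic..].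
  rewrite !Rintegral_correlation//.
  rewrite -Rintegral_lin4; [|exact: iv..].
  by apply: eq_Rintegral => x _; rewrite Re_mulc /=; ring.
- transitivity (\int[mu]_x (correlation Fr Pr x * Hi x
      + (-1) * (correlation Fi Pi x * Hi x) + 1 * (correlation Fr Pi x * Hr x)
      + 1 * (correlation Fi Pr x * Hr x))).
    apply: eq_Rintegral => x _.
    by rewrite Im_mulc Re_ccorrelation// Im_ccorrelation//; ring.
  rewrite Rintegral_lin4; [|exact: ic..].
  rewrite !Rintegral_correlation//.
  rewrite -Rintegral_lin4; [|exact: iv..].
  by apply: eq_Rintegral => x _; rewrite Im_mulc /=; ring.
Qed.

End ComplexIntegral.

(** * Essentially bounded functions on the half-line *)

Section HalfLine.
Context {R : realType}.
Local Notation C := (R[i]).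
Local Notation mu := (@lebesgue_measure R).
Local Notation Re := complex.Re.
Local Notation Im := complex.Im.
Local Notation normc := ComplexField.Normc.normc.
Implicit Types f g h phi F G : R -> C.

Lemma measurable_Rplus : measurable (Rplus R).
Proof.
rewrite (_ : Rplus R = `[0, +oo[%classic); last first.
  by apply/seteqP; split=> x; rewrite /Rplus/= in_itv/= andbT.
exact: measurable_itv.
Qed.

Lemma Re_phitilde h :
  (fun x => Re (phitilde h x)) = ((fun x => Re (h x)) : R -> R) \_ (Rplus R).
Proof.
apply/funext => x; rewrite patchE /phitilde.
have -> : (x \in Rplus R) = (0 <= x) by apply/idP/idP; rewrite inE.
by case: ifP.
Qed.

Lemma Im_phitilde h :
  (fun x => Im (phitilde h x)) = ((fun x => Im (h x)) : R -> R) \_ (Rplus R).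
Proof.
apply/funext => x; rewrite patchE /phitilde.
have -> : (x \in Rplus R) = (0 <= x) by apply/idP/idP; rewrite inE.
by case: ifP.
Qed.

Lemma integrable_restrictT (D : set R) (f : R -> R) : measurable D ->
  mu.-integrable D (EFin \o f) -> mu.-integrable setT (EFin \o (f \_ D)).
Proof.
move=> mD iD; have := (@integrable_mkcond _ _ _ mu D (EFin \o f) mD).1 iD.
by rewrite restrict_EFin.
Qed.

Lemma measurable_phitilde h :
  cmeasurable (Rplus R) h -> cmeasurable setT (phitilde h).
Proof.
move=> [mr mi]; split.
- by rewrite Re_phitilde; exact: (measurable_restrictT _ measurable_Rplus).1 mr.
- by rewrite Im_phitilde; exact: (measurable_restrictT _ measurable_Rplus).1 mi.
Qed.

Lemma L1_phitilde h : L1 (Rplus R) h -> L1 setT (phitilde h).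
Proof.
move=> [mh [ir ii]]; split; first exact: measurable_phitilde.
have jr := integrable_restrictT _ _ measurable_Rplus ir.
have ji := integrable_restrictT _ _ measurable_Rplus ii.
by rewrite -Re_phitilde in jr; rewrite -Im_phitilde in ji.
Qed.

Lemma L1_Rplus h : L1 setT h -> L1 (Rplus R) h.
Proof.
move=> [[mr mi] [ir ii]]; split; first by split; exact: measurable_funTS.
split.
- exact: (@integrableS _ _ _ mu _ _ _ measurableT measurable_Rplus
    (@subsetT _ _) ir).
- exact: (@integrableS _ _ _ mu _ _ _ measurableT measurable_Rplus
    (@subsetT _ _) ii).
Qed.

Lemma L1_translate a h : L1 setT h -> L1 setT (fun x => h (x + a)).
Proof.
move=> [[mr mi] [ir ii]]; split.
  by split; [exact: (measurable_translate a _ mr)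
            |exact: (measurable_translate a _ mi)].
split; [exact: (integrable_translate a _ ir)|exact: (integrable_translate a _ ii)].
Qed.

Lemma cbounded_measurable_translate a F :
  cbounded_measurable F -> cbounded_measurable (fun x => F (x + a)).
Proof.
by move=> [bFr bFi]; split; [exact: (bounded_measurable_translate a _ bFr)
                            |exact: (bounded_measurable_translate a _ bFi)].
Qed.

Lemma Linf_cbounded_measurable g G : cbounded_measurable G ->
  (forall x, 0 <= x -> g x = G x) -> Linf (Rplus R) g.
Proof.
move=> [[mr [M Mr]] [mi [N Ni]]] gG; split.
  split.
  - apply: (@eq_measurable_fun _ _ _ _ _ (fun x => Re (G x))).
      by move=> x; rewrite inE => x0; rewrite gG.
    exact: measurable_funTS.
  - apply: (@eq_measurable_fun _ _ _ _ _ (fun x => Im (G x))).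
      by move=> x; rewrite inE => x0; rewrite gG.
    exact: measurable_funTS.
exists (M + N); apply: aeW => x x0; rewrite gG//.
by rewrite (le_trans (normc_le_ReIm _))// lerD.
Qed.

Lemma Linf_translate a g : 0 <= a -> Linf (Rplus R) g ->
  Linf (Rplus R) (fun x => g (a + x)).
Proof.
move=> a0 [mg [M gM]]; have [mr mi] := measurable_phitilde _ mg; split.
  have tilde x : x \in Rplus R -> phitilde g (x + a) = g (a + x).
    by rewrite inE /Rplus/= /phitilde addrC => x0; rewrite addr_ge0.
  split.
  - apply: (@eq_measurable_fun _ _ _ _ _ (fun x : R => Re (phitilde g (x + a)))).
      by move=> x x0; rewrite tilde.
    by apply: measurable_funTS; exact: (measurable_translate a _ mr).
  - apply: (@eq_measurable_fun _ _ _ _ _ (fun x : R => Im (phitilde g (x + a)))).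
      by move=> x x0; rewrite tilde.
    by apply: measurable_funTS; exact: (measurable_translate a _ mi).
exists M; apply: ae_impl (ae_translate a _ gM) => x; rewrite /Rplus/= addrC.
by move=> + x0; apply; exact: addr_ge0.
Qed.

Lemma bounded_measurable_clamp (M : R) (g : R -> R) : measurable_fun setT g ->
  bounded_measurable (fun x => Num.max (- `|M|) (Num.min `|M| (g x))).
Proof.
move=> mg; split.
  by apply: measurable_maxr => //; apply: measurable_minr.
exists `|M| => x; rewrite ler_norml le_max lexx/= ge_max ge_min lexx/= andbT.
by rewrite ge0_cp// ?normr_ge0.
Qed.

Lemma clampK (M r : R) : `|r| <= M -> Num.max (- `|M|) (Num.min `|M| r) = r.
Proof.
move=> rM; have rM' : `|r| <= `|M| := le_trans rM (ler_norm M).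
move: rM'; rewrite ler_norml => /andP[Mr rM'].
by rewrite min_r// max_r.
Qed.

(** Clamping both parts of the zero extension at the essential bound changes them on a null set
    only. The levels are [|M|] and [- |M|], since the sign of [M] is unknown; thus 0 is fixed on the
    negative half-line. *)
Lemma Linf_bounded_rep g : Linf (Rplus R) g ->
  exists2 G, cbounded_measurable G & {ae mu, forall x, phitilde g x = G x}.
Proof.
move=> [mg [M gM]]; have [mr mi] := measurable_phitilde _ mg.
pose clamp (r : R) := Num.max (- `|M|) (Num.min `|M| r).
exists (fun x => Complex (clamp (Re (phitilde g x))) (clamp (Im (phitilde g x)))).
  by split; apply: bounded_measurable_clamp.
apply: ae_impl gM => x; rewrite /phitilde /Rplus/= => gM.
case: ifPn => [/gM {}gM|_].
  apply: complex_eq; rewrite /clamp/= clampK//.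
  - exact: le_trans (le_Re_normc _) gM.
  - exact: le_trans (le_Im_normc _) gM.
by apply: complex_eq; rewrite /clamp/= min_r// max_r// oppr_le0.
Qed.

Lemma Ustar_ccorrelation g phi x : Ustar phi g x = ccorrelation g (phitilde phi) x.
Proof.
rewrite /Ustar cint_mkcond -(cint_translate x); apply: eq_cint => t _.
rewrite addrK /phitilde [t + x]addrC.
have -> : (x + t \in [set t : R | x <= t]) = (0 <= t).
  by apply/idP/idP; rewrite inE/= lerDl.
by case: ifP => // _; rewrite mulr0.
Qed.

(** For [x >= 0] the correlation reads [g] on the half-line only and ignores null sets, so the
    equality holds at every such [x]. *)
Lemma ccorrelation_rep g G phi x : {ae mu, forall x, phitilde g x = G x} ->
  0 <= x -> ccorrelation g (phitilde phi) x = ccorrelation G (phitilde phi) x.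
Proof.
move=> /(ae_translate x) gG x0; apply: cint_ae_eq; apply: ae_impl gG => t + _.
rewrite /phitilde [t + x]addrC; case: (leP 0 t) => [t0|_ _]; last by rewrite !mulr0.
by rewrite addr_ge0// => ->.
Qed.

Lemma Linf_ccorrelation g phi : Linf (Rplus R) g -> L1 (Rplus R) phi ->
  Linf (Rplus R) (ccorrelation g (phitilde phi)).
Proof.
move=> /Linf_bounded_rep[G bG gG] iphi.
apply: (Linf_cbounded_measurable _ (ccorrelation G (phitilde phi))).
  by apply: cbounded_measurable_ccorrelation => //; exact: L1_phitilde.
by move=> x x0; exact: ccorrelation_rep.
Qed.

(** If [y < 0], then [x] and [y - x] are never both nonnegative, so all the integrands vanish
    identically. *)
Lemma cconvolution_lt0 h phi y : y < 0 ->
  cconvolution (phitilde h) (phitilde phi) y = 0.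
Proof.
move=> y0.
have conv0 (p q : C -> R) : p 0 = 0 -> q 0 = 0 ->
    convolution (fun x => p (phitilde h x)) (fun x => q (phitilde phi x)) y = 0.
  move=> p0 q0; rewrite /convolution (_ : (fun _ => _) = cst 0) ?Rintegral_cst//.
    by rewrite mul0r.
  apply/funext => x /=; rewrite /phitilde; case: (leP 0 x) => [x0|_].
    by rewrite leNgt ltrBlDr (lt_le_trans y0) ?add0r// q0 mulr0.
  by rewrite p0 mul0r.
by apply: complex_eq => /=; rewrite !conv0// ?subrr ?addr0.
Qed.

(** The adjunction is applied to the translate by [s] of a bounded representative [G] of [g].
    Returning to [g] is possible for [y >= 0] since then [y + s >= 0], and for [y < 0] the
    convolution vanishes. *)
Lemma pairing_ccorrelation g h phi s : Linf (Rplus R) g -> L1 (Rplus R) h ->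
  L1 (Rplus R) phi -> 0 <= s ->
  cint (Rplus R) (fun x => ccorrelation g (phitilde phi) (x + s) * h x) =
  cint (Rplus R) (fun y => g (y + s) * cconvolution (phitilde h) (phitilde phi) y).
Proof.
move=> /Linf_bounded_rep[G bG gG] /L1_phitilde ih /L1_phitilde iphi s0.
rewrite !cint_Rplus.
transitivity (cint setT (fun x =>
    ccorrelation (fun y => G (y + s)) (phitilde phi) x * phitilde h x)).
  apply: eq_cint => x _; rewrite {1}/phitilde [in RHS]/phitilde.
  case: (leP 0 x) => [x0|_]; last by rewrite mulr0.
  congr (_ * _); rewrite (ccorrelation_rep _ G) ?addr_ge0//.
  by apply: eq_cint => t _; rewrite addrAC.
rewrite cint_ccorrelation//; last exact: cbounded_measurable_translate.
apply: cint_ae_eq; apply: ae_impl (ae_translate s _ gG) => y gGy _.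
rewrite [in RHS]/phitilde; case: (leP 0 y) => [y0|y0].
  by rewrite -gGy /phitilde addr_ge0.
by rewrite cconvolution_lt0// mulr0.
Qed.

Lemma convol_phistar F phi x :
  convol F (phistar phi) x = ccorrelation F (phitilde phi) x.
Proof.
rewrite /convol -(cint_reflect 0); apply: cint_ae_eq.
(* The integrands can differ only at [t = 0], where [phistar phi] is 0 and [phitilde phi] is
   [phi 0]. *)
exists [set 0]; split => //; first exact: lebesgue_measure_set1.
move=> t /= ne; apply: contrapT => t0; apply: ne => _.
rewrite sub0r opprK /phistar /phitilde opprK oppr_lt0.
suff -> : (0 < t) = (0 <= t) by [].
by rewrite lt_neqAle eq_sym; move/eqP/negbTE: t0 => ->.
Qed.

End HalfLine.

(** * Limits along an ultrafilter *)

Section OmegaLimits.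
Context {R : realType}.
Local Notation C := (R[i]).
Local Notation mu := (@lebesgue_measure R).
Local Notation Re := complex.Re.
Local Notation Im := complex.Im.
Local Notation normc := ComplexField.Normc.normc.
Implicit Types (eta : set (set nat)) (f g h phi F G : R -> C).

Lemma omega_lim_congr eta (u : R) (a b : R -> C) (l : C) : 0 <= u ->
  (forall s, 0 <= s -> a s = b s) -> omega_lim eta u a l -> omega_lim eta u b l.
Proof.
move=> u0 ab al e e0; have [A [etaA Aa]] := al e e0.
by exists A; split=> // n /Aa /=; rewrite ab// addr_ge0.
Qed.

(** Two members of [eta] meet, and at a common index a value would lie within half the distance of
    both limits. The argument is run on real and imaginary parts, which are contractions. *)
Lemma omega_lim_unique eta (u : R) (a : R -> C) (l m : C) : is_ultrafilter eta ->
  omega_lim eta u a l -> omega_lim eta u a m -> l = m.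
Proof.
move=> [eta0 _ etaI _ _] al am.
have eq_proj (p : C -> R) : (forall z, `|p z| <= normc z) ->
    (forall z w, p (z - w) = p z - p w) -> p l = p m.
  move=> p_normc pB; apply/eqP; rewrite -subr_eq0; apply/negPn/negP => ne.
  have e0 : 0 < `|p l - p m| / 2 by rewrite divr_gt0// normr_gt0.
  have [A [etaA Al]] := al _ e0; have [B [etaB Bm]] := am _ e0.
  have [n [An Bn]] : A `&` B !=set0.
    by apply/set0P/eqP => AB0; apply: eta0; rewrite -AB0; exact: etaI.
  have /= := le_lt_trans (p_normc _) (Al n An).
  have /= := le_lt_trans (p_normc _) (Bm n Bn).
  rewrite !pB; set v := p (a _) => h1 h2.
  have := ler_normB (v - p m) (v - p l).
  rewrite (_ : v - p m - (v - p l) = p l - p m); last ring.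
  rewrite leNgt => /negP; apply.
  rewrite [ltRHS](splitr _); exact: ltrD.
apply: complex_eq; apply: eq_proj.
- exact: le_Re_normc.
- by move=> [? ?] [? ?].
- exact: le_Im_normc.
- by move=> [? ?] [? ?].
Qed.

Lemma iter_tauinv eta N (B : set nat) :
  iter N tauinv eta B = eta ((fun n => (n + N)%N) @` B).
Proof.
elim: N B => [|N IH] B /=.
  congr eta; apply/seteqP.
  by split=> [n Bn|_ [n Bn <-]]; [exists n|]; rewrite ?addn0.
rewrite /tauinv/= IH; congr eta; apply/seteqP; split=> n.
  by move=> [_ [m Bm <-] <-]; exists m => //; rewrite addnS addSn.
by move=> [m Bm <-]; exists m.+1; [exists m|rewrite addnS addSn].
Qed.

(** Indicators of measurable subsets of [[0, k]] are test functions that determine a bounded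
    function almost everywhere on [[0, k]]; countably many [k] exhaust the half-line. *)
Lemma Linf_unique F G : Linf (Rplus R) F -> Linf (Rplus R) G ->
  (forall h, L1 (Rplus R) h ->
    cint (Rplus R) (fun x => F x * h x) = cint (Rplus R) (fun x => G x * h x)) ->
  {ae mu, forall x, 0 <= x -> F x = G x}.
Proof.
move=> /Linf_bounded_rep[F' bF FF'] /Linf_bounded_rep[G' bG GG'] FG.
have integ (K : R -> R) (E : set R) k : bounded_measurable K ->
    measurable E -> E `<=` `[0, k%:R]%classic -> mu.-integrable E (EFin \o K).
  move=> [mK [M KM]] mE Ek.
  apply: (@measurable_bounded_integrable _ _ _ mu) => //.
  - apply: (@le_lt_trans _ _ (mu `[0, k%:R]%classic)).
      by apply: le_measure; rewrite ?inE.
    by rewrite lebesgue_measure_itv/=; case: ifP; rewrite -?EFinB ltry.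
  - exact: measurable_funTS.
  - exists M; split=> [|N MN x _ /=]; first exact: num_real.
    exact: le_trans (KM x) (ltW MN).
have eq_on k (E : set R) : E `<=` `[0, k%:R]%classic -> measurable E ->
    cint setT (fun x => F' x * (\1_E x)%:C%C) =
    cint setT (fun x => G' x * (\1_E x)%:C%C).
  move=> Ek mE; pose h (x : R) : C := (\1_E x)%:C%C.
  have E0 x : x < 0 -> h x = 0.
    move=> x0; rewrite /h indicE memNset// => /Ek/=.
    by rewrite in_itv/= leNgt x0.
  have ih : L1 setT h.
    have i1 : mu.-integrable setT (EFin \o (\1_E : R -> R)).
      have i1 := integ _ _ _ (bounded_measurable_cst 1) mE Ek.
      have := integrable_restrictT _ _ mE i1.
      by congr integrable; apply/funext => x; rewrite /= patchE indicE; case: ifP.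
    split.
      by split => //=; apply/measurable_EFinP; exact: (measurable_int _ i1).
    by split => //=; exact: integrable0.
  have := FG h (L1_Rplus _ ih); rewrite !cint_Rplus.
  suff rep (K K' : R -> C) : {ae mu, forall x, phitilde K x = K' x} ->
      cint setT (phitilde (fun x => K x * h x)) = cint setT (fun x => K' x * h x).
    by rewrite (rep F F')// (rep G G').
  move=> KK'; apply: cint_ae_eq; apply: ae_impl KK' => x + _.
  rewrite /phitilde; case: (leP 0 x) => [_ ->//|x0 _].
  by rewrite E0// mulr0.
(* [p] stands for the real or the imaginary part. *)
have ae_on (p : C -> R) : bounded_measurable (fun x => p (F' x)) ->
    bounded_measurable (fun x => p (G' x)) ->
    (forall k (E : set R), E `<=` `[0, k%:R]%classic -> measurable E ->
      \int[mu]_x (p (F' x) * \1_E x) = \int[mu]_x (p (G' x) * \1_E x)) ->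
    {ae mu, forall x, 0 <= x -> p (F' x) = p (G' x)}.
  move=> bpF bpG pFG.
  suff aek k : ae_eq mu `[0, k%:R]%classic
      (fun x => (p (F' x))%:E) (fun x => (p (G' x))%:E).
    apply: ae_impl (ae_foralln aek) => x Fx x0.
    have [k kx] : exists k : nat, x <= k%:R.
      by exists (Num.truncn x).+1; exact: ltW (truncnS_gt _).
    suff : (p (F' x))%:E = (p (G' x))%:E by case.
    by apply: (Fx k); rewrite /= in_itv/= x0.
  apply: integral_ae_eq => //.
  - exact: (integ (fun x => p (F' x)) _ k).
  - by apply/measurable_EFinP; apply: measurable_funTS; case: bpG.
  - move=> E Ek mE.
    have indE (K : R -> R) : \int[mu]_x (K x * \1_E x) = \int[mu]_(x in E) K x.
      rewrite [RHS]Rintegral_mkcond; apply: eq_Rintegral => x _.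
      by rewrite patchE indicE; case: ifP => _; rewrite ?mulr1 ?mulr0.
    (* The real values of the integrals agree; finiteness lifts this to the extended reals. *)
    have := pFG k E Ek mE; rewrite !indE /Rintegral => fineE.
    rewrite -[LHS]fineK; last first.
      exact: (integrable_fin_num mE (integ _ _ _ bpF mE Ek)).
    rewrite -[RHS]fineK; last first.
      exact: (integrable_fin_num mE (integ _ _ _ bpG mE Ek)).
    by rewrite fineE.
have ReFG : {ae mu, forall x, 0 <= x -> Re (F' x) = Re (G' x)}.
  apply: ae_on; [exact: bF.1|exact: bG.1|] => k E Ek mE.
  have /(congr1 (@complex.Re R)) := eq_on k E Ek mE; rewrite /cint/= => ReE.
  transitivity (\int[mu]_x Re (F' x * (\1_E x)%:C%C)); last rewrite ReE;
    by apply: eq_Rintegral => x _; rewrite Re_mulc/= mulr0 subr0.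
have ImFG : {ae mu, forall x, 0 <= x -> Im (F' x) = Im (G' x)}.
  apply: ae_on; [exact: bF.2|exact: bG.2|] => k E Ek mE.
  have /(congr1 (@complex.Im R)) := eq_on k E Ek mE; rewrite /cint/= => ImE.
  transitivity (\int[mu]_x Im (F' x * (\1_E x)%:C%C)); last rewrite ImE;
    by apply: eq_Rintegral => x _; rewrite Im_mulc/= mulr0 add0r.
have FG'_eq : {ae mu, forall x, 0 <= x -> F' x = G' x}.
  apply: ae_impl2 ReFG ImFG => x rE iE x0.
  by apply: complex_eq; [exact: rE|exact: iE].
have FG' : {ae mu, forall x, 0 <= x -> F x = G' x}.
  apply: ae_impl2 FF' FG'_eq => x + FG'x x0.
  by rewrite /phitilde x0 FG'x.
apply: ae_impl2 GG' FG' => x + FG'x x0.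
by rewrite /phitilde x0 FG'x.
Qed.

(** The half-line case, to be applied both to [eta] and to [iter N tauinv eta]. *)
Lemma omega_rep_Ustar eta (u : R) g G phi : 0 <= u -> Linf (Rplus R) g ->
  L1 (Rplus R) phi -> omega_rep eta u g G ->
  omega_rep eta u (Ustar phi g) (ccorrelation G (phitilde phi)).
Proof.
move=> u0 bg iphi [bG gG]; split; first exact: Linf_ccorrelation.
move=> h ih.
(* The pairing identity for the limit [G], with [s = 0]. *)
have -> : cint (Rplus R) (fun x => ccorrelation G (phitilde phi) x * h x) =
    cint (Rplus R) (fun y => G y * cconvolution (phitilde h) (phitilde phi) y).
  have := pairing_ccorrelation G h phi 0 bG ih iphi (lexx 0).
  by under eq_cint do rewrite addr0; under [in RHS]eq_cint do rewrite addr0.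
apply: omega_lim_congr (gG _ _) => //; last first.
  by apply: L1_Rplus; apply: L1_cconvolution; exact: L1_phitilde.
move=> s s0; rewrite -(pairing_ccorrelation g h phi s bg ih iphi s0).
by apply: eq_cint => x _; rewrite Ustar_ccorrelation.
Qed.

(** Moving [h] to the right by [N] trades the point [u + n] for [u + (n + N)], and [n + N] runs
    through a member of [eta] when [n] runs through a member of [iter N tauinv eta]. *)
Lemma omega_lim_tauinv eta (u : R) N g G h : 0 <= u ->
  omega_rep (iter N tauinv eta) u g G -> L1 (Rplus R) h ->
  omega_lim eta u (fun s => cint (Rplus R) (fun x => g (x + s) * h x))
                  (cint (Rplus R) (fun x => G (N%:R + x) * h x)).
Proof.
move=> u0 [_ gG] ih e e0.
(* The zero extension makes the shifted test function vanish on [[0, N[]. *)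
have ih' : L1 (Rplus R) (fun x => phitilde h (x - N%:R)).
  by apply: L1_Rplus; apply: L1_translate; exact: L1_phitilde.
have shift K : cint (Rplus R) (fun x => K x * phitilde h (x - N%:R)) =
    cint (Rplus R) (fun x => K (x + N%:R) * h x).
  rewrite !cint_Rplus -(cint_translate N%:R); apply: eq_cint => x _.
  rewrite /phitilde addrK; case: (leP 0 x) => [x0|_]; last by rewrite mulr0 if_same.
  by rewrite addr_ge0.
have [A []] := gG _ ih' e e0; rewrite iter_tauinv => etaA Ae.
eexists; split; first exact: etaA.
move=> _ [n An <-]; move: (Ae n An); rewrite /mkset.
rewrite (shift G) (shift (fun x => g (x + (u + n%:R)))).
congr (normc (_ - _) < e); apply: eq_cint => x _; congr (_ * _).
  by congr g; rewrite natrD; ring.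
by rewrite addrC.
Qed.

End OmegaLimits.

(** * The correlation formula on the whole line *)

Theorem theorem4p1 (R : realType) (phi f : R -> R[i])
    (eta : set (set nat)) (u : R) :
  L1 (Rplus R) phi -> Linf (Rplus R) f ->
  in_Nstar eta -> 0 <= u <= 1 ->
  forall F : R -> R[i], omega_ext_rep eta u f F ->
    omega_ext_rep eta u (Ustar phi f)
      (fun x => cint setT (fun t => F (x + t) * phitilde phi t)) /\
    (forall x : R,
      cint setT (fun t => F (x + t) * phitilde phi t) = convol F (phistar phi) x).
Proof.
move=> iphi bf [ueta _] /andP[u0 _] F [repF extF].
split; last by move=> x; rewrite convol_phistar.
split; first exact: omega_rep_Ustar.
move=> N; have [G [repG FG]] := extF N.
exists (ccorrelation G (phitilde phi)); split; first exact: omega_rep_Ustar.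
(* On the half-line both sides are weak* limits of the translates of [f] along [eta]. *)
have FG_ge0 : {ae @lebesgue_measure R, forall x, 0 <= x -> F x = G (N%:R + x)}.
  apply: Linf_unique; first by case: repF.
    by case: repG => bG _; exact: Linf_translate.
  move=> h ih; apply: (omega_lim_unique eta u _ _ _ ueta (repF.2 h ih)).
  exact: omega_lim_tauinv.
have FG_geN : {ae @lebesgue_measure R, forall x, - N%:R <= x -> F x = G (N%:R + x)}.
  apply: ae_impl2 FG FG_ge0 => x FGN FG0 Nx.
  by case: (leP 0 x) => [/FG0//|/ltW x0]; apply: FGN; rewrite Nx.
(* For [x >= - N] the correlation reads [F] only at points [x + t >= - N] and ignores null sets, so
   the equality holds at every such [x]. *)
apply: aeW => x /andP[Nx _]; apply: cint_ae_eq.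
apply: ae_impl (ae_translate x _ FG_geN) => t FGt _.
rewrite {1 2}/phitilde; case: (leP 0 t) => [t0|_]; last by rewrite !mulr0.
by rewrite addrC FGt ?addrA ?[_ + t + x]addrAC//; lra.
Qed.
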